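(* Let $\gamma:\mathbb{R}\to\mathbb{S}^3$ be a complete geodesic of curvature $\lambda\in\mathbb{R}$ in $(\mathbb{S}^3,g_h)$. Then $\gamma$ is a closed curve diffeomorphic to a circle if and only if $\lambda/\sqrt{1+\lambda^2}$ is a rational number. Otherwise $\gamma$ is diffeomorphic to a straight line and there is a right translation $R_q$ ($q\in\mathbb{S}^3$) such that $R_q(\gamma)$ is a dense subset inside a Clifford torus $\mathcal{T}_\rho$ for some $\rho\in(0,1)$.
   Context: Identify $(x_1,y_1,x_2,y_2)\in\mathbb{R}^4$ with the quaternion $x_1+iy_1+jx_2+ky_2$ and with the pair $(z_1,z_2)$, $z_n=x_n+iy_n$; $p\cdot q$ is the quaternion product and $\langle\cdot,\cdot\rangle$ the Euclidean product. $\mathbb{S}^3$ is the unit sphere with the induced Riemannian metric $g$ and Levi-Civita connection $D$. For $q\in\mathbb{S}^3$ the right translation is $R_q(p)=p\cdot q$. Put $V(p)=i\cdot p$, $E_1(p)=j\cdot p$, $E_2(p)=k\cdot p$. The horizontal distribution is the plane distribution spanned by $E_1,E_2$, and $g_h$ (the sub-Riemannian metric) is the restriction of $g$ to it. A curve is horizontal if its tangent vectors lie in this distribution. $J(X):=D_XV$ for tangent $X$; on horizontal vectors $J(X)=i\cdot X$. A geodesic of curvature $\lambda$ in $(\mathbb{S}^3,g_h)$ is a $C^2$ horizontal curve $\gamma$ parameterized by arc-length with $D_{\dot\gamma}\dot\gamma+2\lambda J(\dot\gamma)=0$; it is complete if it is defined on all of $\mathbb{R}$. For $\rho\in(0,1)$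 the Clifford torus is $\mathcal{T}_\rho=\{(z_1,z_2)\in\mathbb{S}^3:|z_1|^2=\rho^2\}$. *)

(* Defs.v *)
From mathcomp Require Export all_boot all_order all_algebra.
From mathcomp Require Export all_classical all_reals all_analysis.
Export Order.TTheory GRing.Theory Num.Theory.
Export numFieldNormedType.Exports.

Set Implicit Arguments.
Unset Strict Implicit.
Unset Printing Implicit Defensive.

Local Open Scope classical_set_scope.
Local Open Scope ring_scope.

Section Smoothness.
Context {R : realType}.

(* Class C^k on the whole space; the recursion through all directional
   derivatives is the usual notion when V is finite-dimensional, the only
   case used below. *)
Fixpoint Ck {V W : normedModType R} (k : nat) (f : V -> W) : Prop :=
  match k with
  | 0 => continuous f
  | k'.+1 => (forall x : V, differentiable f x) /\
             (forall v : V, Ck k' (fun x => 'D_v f x))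
  end.

Definition smooth {V W : normedModType R} (f : V -> W) : Prop :=
  forall k, Ck k f.

(* Here M is a closed embedded 1-dimensional submanifold of V, so that smooth
   maps on M are the restrictions of smooth maps on V.  The regular curve c
   factors as R --h--> M --phi--> W with h onto M and phi injective on M.
   Since c' = dphi(h') never vanishes, h is a local diffeomorphism and phi|M is
   an injective immersion with image c(R): phi is a diffeomorphism of M onto
   c(R), the latter being given the smooth structure for which c is a local
   diffeomorphism.  This is the subspace structure when M is compact, but it
   cannot be when c(R) accumulates on itself. *)
Definition curve_diffeomorphic_to {V W : normedModType R}
    (c : R -> W) (M : set V) : Prop :=
  (forall t, derive1 c t != 0) /\
  exists (h : R -> V) (phi : V -> W),
    [/\ smooth h, range h = M, smooth phi, set_inj M phi
      & forall t, c t = phi (h t)].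

Definition closed_curve {W : normedModType R} (c : R -> W) : Prop :=
  exists2 T : R, 0 < T & periodic c T.

Definition unit_circle : set 'rV[R]_2 :=
  [set v | v 0 0 ^+ 2 + v 0 1 ^+ 2 = 1].

Definition straight_line : set R := [set: R].

Definition dense_in {T : topologicalType} (A B : set T) : Prop :=
  A `<=` B /\ B `<=` closure A.

Definition rational (x : R) : Prop := exists r : rat, x = ratr r.

End Smoothness.

Section SubRiemannianSphere.
Context {R : realType}.
Implicit Types (p q u v : 'rV[R]_4).

Definition dot u v : R := \sum_(i < 4) u 0 i * v 0 i.

Definition quat (a b c d : R) : 'rV[R]_4 := \row_(i < 4) [:: a; b; c; d]`_i.

Definition qmul p q : 'rV[R]_4 :=
  let: (a, b, c, d) := (p 0 0, p 0 1, p 0 2, p 0 3) in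
  let: (a', b', c', d') := (q 0 0, q 0 1, q 0 2, q 0 3) in
  quat (a * a' - b * b' - c * c' - d * d')
       (a * b' + b * a' + c * d' - d * c')
       (a * c' - b * d' + c * a' + d * b')
       (a * d' + b * c' - c * b' + d * a').

Definition qi : 'rV[R]_4 := quat 0 1 0 0.
Definition qj : 'rV[R]_4 := quat 0 0 1 0.
Definition qk : 'rV[R]_4 := quat 0 0 0 1.

Definition S3 : set 'rV[R]_4 := [set p | dot p p = 1].

Definition right_translation q p : 'rV[R]_4 := qmul p q.

Definition fieldV p : 'rV[R]_4 := qmul qi p.
Definition fieldE1 p : 'rV[R]_4 := qmul qj p.
Definition fieldE2 p : 'rV[R]_4 := qmul qk p.

Definition horizontal_vector p v : Prop :=
  exists a b : R, v = a *: fieldE1 p + b *: fieldE2 p.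

(* Orthogonal projection onto T_p S^3 = p^\perp, for p in S^3. *)
Definition tangent_proj p v : 'rV[R]_4 := v - dot v p *: p.

(* The Levi-Civita connection of the metric induced on S^3 is the tangential
   part of the derivative in R^4: for a field Y (here any extension to R^4)
   in the direction X at p, and for a field Y along a curve c. *)
Definition cov_deriv (Y : 'rV[R]_4 -> 'rV[R]_4) p (X : 'rV[R]_4) : 'rV[R]_4 :=
  tangent_proj p ('D_X Y p).

Definition cov_deriv_along (c Y : R -> 'rV[R]_4) (t : R) : 'rV[R]_4 :=
  tangent_proj (c t) (derive1 Y t).

Definition J p (X : 'rV[R]_4) : 'rV[R]_4 := cov_deriv fieldV p X.

(* [Ck 2] for maps into R^4 coincides with C^2 as a map into S^3. *)
Definition complete_geodesic (lambda : R) (c : R -> 'rV[R]_4) : Prop :=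
  [/\ forall t, S3 (c t),
      Ck 2 c,
      forall t, horizontal_vector (c t) (derive1 c t),
      forall t, dot (derive1 c t) (derive1 c t) = 1
    & forall t, cov_deriv_along c (derive1 c) t
                + (2 * lambda) *: J (c t) (derive1 c t) = 0].

(* |z_1|^2 = x_1^2 + y_1^2. *)
Definition clifford_torus (rho : R) : set 'rV[R]_4 :=
  [set p | S3 p /\ p 0 0 ^+ 2 + p 0 1 ^+ 2 = rho ^+ 2].

End SubRiemannianSphere.

(* Main.v *)
Require Import Defs.
From mathcomp Require Import ring lra.

(** In R^4, identified with C^2 through left multiplication by i, the
    equation of geodesics is linear:
      gamma'' + 2 lambda i gamma' + gamma = 0
    ([geodesic_equation]).  Its characteristic frequencies are
    mu1 = s - lambda and mu2 = - (s + lambda), with s = sqrt (1 + lambda^2), so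
      gamma t = exp(i mu1 t) A + exp(i mu2 t) B,
    and the initial conditions of a horizontal unit-speed curve force A and B to
    be nonzero and Hermitian orthogonal ([geodesic_helix]).  The coefficients
    exp(i mu1 t) and exp(i mu2 t) can then be read off from gamma t
    ([frame_inj]), and everything is decided by the ratio of the frequencies.

    If gamma passes twice through the same point, then mu2 / mu1 is the quotient
    of two integers ([helix_collision_rational]), and
    lambda / s = (mu2 / mu1 + 1) / (mu2 / mu1 - 1) is rational.

    If lambda / s is rational, then mu1 = m tau and mu2 = - n tau with m and n
    coprime; gamma is periodic, and it factors through the unit circle by the
    polynomial map z |-> z^m A + conj(z)^n B, injective there because m and n
    are coprime ([helix_circle_param]).

    If lambda / s is irrational, gamma is injective.  A right translation
    commutes with left multiplication by i, and a suitable one takes A to the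
    real axis and B to the plane of j and k, so that the translated curve winds
    around a Clifford torus with an irrational ratio of frequencies.  It is
    dense there ([helix_dense]) since Z kappa + Z is dense in R for kappa
    irrational ([irrational_combinations_dense]). *)

Set Implicit Arguments.
Unset Strict Implicit.
Unset Printing Implicit Defensive.

Local Open Scope classical_set_scope.
Local Open Scope ring_scope.

Section Geodesics.
Context {R : realType}.
Implicit Types (V W : normedModType R) (A B u v w p q : 'rV[R]_4).
Implicit Types (a b c d : R).

(** * Maps of class C^k and smooth maps *)

Lemma CkW V W k (f : V -> W) : Ck k.+1 f -> Ck k f.
Proof.
elim: k f => [|k IH] f [df Df]; last by split=> // v; apply/IH/Df.
by move=> x; exact/differentiable_continuous.
Qed.

Lemma smooth_cst V W (a : W) : smooth (fun _ : V => a).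
Proof.
move=> k; elim: k a => [|k IH] a; first exact: cst_continuous.
split=> [x|v]; first exact: differentiable_cst.
under eq_fun do rewrite derive_cst.
exact: IH.
Qed.

Lemma CkD V W k (f g : V -> W) : Ck k f -> Ck k g ->
  Ck k (fun x => f x + g x).
Proof.
elim: k f g => [|k IH] f g.
  by move=> cf cg x; apply: continuousD; [exact: cf|exact: cg].
move=> [df Df] [dg Dg]; split=> [x|v]; first exact: differentiableD.
have -> : (fun x => 'D_v (fun y => f y + g y) x) =
          (fun x => 'D_v f x + 'D_v g x).
  by apply/funext=> x; rewrite deriveD//; exact: diff_derivable.
by apply: IH; [exact: Df|exact: Dg].
Qed.

(** Scalar functions times constant vectors are enough here: every curve below
    is a combination of fixed vectors with scalar coefficients. *)
Lemma CkZl V W k (f : V -> R) (w : W) : Ck k f -> Ck k (fun x => f x *: w).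
Proof.
elim: k f => [|k IH] f.
  by move=> cf x; apply: continuousZr_tmp; exact: cf.
move=> [df Df]; split=> [x|v]; first exact: differentiableZl.
have -> : (fun x => 'D_v (fun y => f y *: w) x) = (fun x => 'D_v f x *: w).
  apply/funext=> x; rewrite !deriveE//; last exact: differentiableZl.
  by rewrite diffZl.
exact/IH/Df.
Qed.

Lemma CkM V k (f g : V -> R) : Ck k f -> Ck k g -> Ck k (fun x => f x * g x).
Proof.
elim: k f g => [|k IH] f g.
  by move=> cf cg x; apply: continuousM; [exact: cf|exact: cg].
move=> Cf Cg; have [[df Df] [dg Dg]] := (Cf, Cg).
split=> [x|v]; first exact: differentiableM.
have -> : (fun x => 'D_v (fun y => f y * g y) x) =
          (fun x => f x * 'D_v g x + g x * 'D_v f x).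
  by apply/funext=> x; rewrite deriveM//; exact: diff_derivable.
by apply: CkD; apply: IH; [exact: CkW|exact: Dg|exact: CkW|exact: Df].
Qed.

Lemma smooth_coord n (i : 'I_n) : smooth (fun v : 'rV[R]_n => v 0 i).
Proof.
case=> [|k]; first exact: coord_continuous.
split=> [v|w]; first exact: differentiable_coord.
have -> : (fun x : 'rV[R]_n => 'D_w (fun v : 'rV[R]_n => v 0 i) x) =
          (fun=> w 0 i).
  have D x : derivable (fun v : 'rV[R]_n => v) x w by exact: derivable_id.
  apply/funext=> x; have /rowP/(_ i) := derive_mx (D x).
  by rewrite derive_id mxE.
exact: smooth_cst.
Qed.

Lemma is_derive_cosM (mu t : R) :
  is_derive t 1 (fun t => cos (mu * t)) (- mu * sin (mu * t)).
Proof.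
have dm : is_derive t 1 (fun t => mu * t) mu.
  by apply: is_derive_eq; rewrite /GRing.scale/= mulr1.
apply: is_derive_eq.
by rewrite /GRing.scale/=; ring.
Qed.

Lemma is_derive_sinM (mu t : R) :
  is_derive t 1 (fun t => sin (mu * t)) (mu * cos (mu * t)).
Proof.
have dm : is_derive t 1 (fun t => mu * t) mu.
  by apply: is_derive_eq; rewrite /GRing.scale/= mulr1.
apply: is_derive_eq.
by rewrite /GRing.scale/=; ring.
Qed.

(** Taking both coefficients arbitrary gives a family stable under directional
    derivatives, which is what the induction on the order needs. *)
Lemma smooth_trig (a b mu : R) :
  smooth (fun t => a * cos (mu * t) + b * sin (mu * t)).
Proof.
have d (a' b' t : R) :
    is_derive t 1 (fun t => a' * cos (mu * t) + b' * sin (mu * t))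
    (mu * b' * cos (mu * t) - mu * a' * sin (mu * t)).
  have := is_derive_cosM mu t; have := is_derive_sinM mu t => ? ?.
  by apply: is_derive_eq; rewrite /GRing.scale/=; ring.
have df (a' b' t : R) :
    differentiable (fun t => a' * cos (mu * t) + b' * sin (mu * t)) t.
  exact/derivable1_diffP.
move=> k; elim: k a b => [|k IH] a b.
  by move=> x; apply: differentiable_continuous.
split=> [x|v]; first exact: df.
have -> : (fun t => 'D_v (fun t => a * cos (mu * t) + b * sin (mu * t)) t) =
   (fun t => v * mu * b * cos (mu * t) + (- v * mu * a) * sin (mu * t)).
  apply/funext => x; rewrite deriveE//.
  have -> := deriv1E (proj2 (derivable1_diffP _ _) (df a b x)).
  rewrite derive1E (@derive_val _ _ _ _ _ _ _ (d a b x)).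
  by rewrite /GRing.scale/=; ring.
exact: IH.
Qed.

Lemma smooth_cosM (mu : R) : smooth (fun t => cos (mu * t)).
Proof.
rewrite (_ : (fun _ => _) = fun t => 1 * cos (mu * t) + 0 * sin (mu * t)).
  exact: smooth_trig.
by apply/funext => t; ring.
Qed.

Lemma smooth_sinM (mu : R) : smooth (fun t => sin (mu * t)).
Proof.
rewrite (_ : (fun _ => _) = fun t => 0 * cos (mu * t) + 1 * sin (mu * t)).
  exact: smooth_trig.
by apply/funext => t; ring.
Qed.

(** * Angles and irrational rotations *)

Lemma polar_coordinates (x y : R) : x ^+ 2 + y ^+ 2 = 1 ->
  exists theta, x = cos theta /\ y = sin theta.
Proof.
move=> xy1; have x1 : -1 <= x <= 1 by apply/andP; split; nra.
have sacos : sin (acos x) = `|y|.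
  by rewrite sin_acos// -xy1 addrAC subrr add0r sqrtr_sqr.
have [y0|y0] := leP 0 y.
  by exists (acos x); rewrite acosK ?in_itv// sacos ger0_norm.
exists (- acos x); rewrite cosN sinN acosK ?in_itv// sacos.
by rewrite ltr0_norm ?opprK.
Qed.

Lemma trigD2pi_int (x : R) (m : int) :
  (cos (x + m%:~R * (pi *+ 2)) = cos x) * (sin (x + m%:~R * (pi *+ 2)) = sin x).
Proof.
have nat_case (n : nat) (y : R) :
    (cos (y + n%:R * (pi *+ 2)) = cos y) * (sin (y + n%:R * (pi *+ 2)) = sin y).
  by split; rewrite mulr_natl periodicn//; [exact: cosD2pi|exact: sinD2pi].
case: m => n; first exact: nat_case.
by rewrite NegzE mulrNz mulNr; split; rewrite -(nat_case n.+1 (x - _)) subrK.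
Qed.

Lemma cos_eq1 (x : R) : cos x = 1 -> exists m : int, x = m%:~R * (pi *+ 2).
Proof.
move=> cx; have p0 : 0 < (pi : R) *+ 2 by rewrite pmulrn_lgt0 ?pi_gt0.
pose m := Num.floor (x / (pi *+ 2)); exists m.
pose y := x - m%:~R * (pi *+ 2).
have cy : cos y = 1.
  by rewrite -cx -(trigD2pi_int y m) subrK.
have y0 : 0 <= y by rewrite subr_ge0 -ler_pdivlMr// floor_le.
have y2 : y < pi *+ 2.
  have := floorD1_gt (x / (pi *+ 2)).
  by rewrite ltr_pdivrMr// intrD mulrDl mul1r addrC -ltrBlDr.
suff : y = 0 by move/subr0_eq.
apply/eqP; case: ltgtP y0 => // ylt0 _; exfalso.
have sy : 0 < sin (y / 2).
  apply: sin_gt0_pi; rewrite divr_gt0//= ltr_pdivrMr// mulr_natr //.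
move: cy; rewrite {1}(splitr y) -mulr2n cos_mulr2n cos2sin2 => cy.
nra.
Qed.

Lemma equal_angles (x y : R) : cos x = cos y -> sin x = sin y ->
  exists m : int, x - y = m%:~R * (pi *+ 2).
Proof.
move=> cxy sxy; apply: cos_eq1.
by rewrite cosB cxy sxy -!expr2 cos2Dsin2.
Qed.

(** A descent in Z kappa + Z.  Let x = m kappa + n, with m nonzero and
    0 < x <= 1, and let l be the floor of 1/x.  Then 1 - l x and (l + 1) x - 1
    are in the group, are nonnegative and add up to x, so one of them is at most
    x/2.  The coefficients of kappa in them are multiples of m by - l and l + 1,
    hence nonzero; by irrationality neither number vanishes, and the halving can
    be repeated. *)
Lemma irrational_combination_small (kappa e : R) : ~ rational kappa -> 0 < e ->
  exists m n : int, 0 < m%:~R * kappa + n%:~R < e.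
Proof.
move=> kirr e0.
have nz (m n : int) : m != 0 -> m%:~R * kappa + n%:~R != 0.
  move=> m0; apply/eqP => h; apply: kirr; exists (- n%:~R / m%:~R).
  rewrite fmorph_div rmorphN !rmorph_int.
  apply: (canRL (mulfK _)); first by rewrite intr_eq0.
  by move: h; rewrite mulrC => /eqP; rewrite addr_eq0 => /eqP.
have halving k : exists m n : int,
    m != 0 /\ 0 < m%:~R * kappa + n%:~R <= 2 ^- k.
  elim: k => [|k [m [n [m0]]]].
    exists 1, (- Num.floor kappa); split=> //.
    rewrite lt_neqAle eq_sym nz//= expr0 invr1 mul1r mulrNz subr_ge0 floor_le/=.
    by rewrite lerBlDl -(intrD _ _ 1) ltW// floorD1_gt.
  set x := m%:~R * kappa + n%:~R => /andP[x0 xk].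
  pose l := Num.floor x^-1.
  have x1 : x <= 1.
    by apply: (le_trans xk); rewrite invf_le1 ?exprn_gt0// exprn_ege1 ?ler1n.
  have l1 : (1 <= l)%R by rewrite floor_ge_int invf_ge1.
  have ll : l%:~R * x <= 1 by rewrite -ler_pdivlMr// div1r floor_le.
  have lr : 1 < (l + 1)%:~R * x by rewrite -ltr_pdivrMr// div1r floorD1_gt.
  have rE : 1 - l%:~R * x = (- (l * m))%:~R * kappa + (1 - l * n)%:~R.
    by rewrite /x mulrNz intrB !intrM; ring.
  have r'E : (l + 1)%:~R * x - 1 =
      ((l + 1) * m)%:~R * kappa + ((l + 1) * n - 1)%:~R.
    by rewrite /x intrB !intrM; ring.
  have ek : 2 ^- k.+1 = 2 ^- k / 2 :> R by rewrite exprS invfM mulrC.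
  rewrite intrD in lr r'E.
  have [h|h] := leP (1 - l%:~R * x) (x / 2).
    exists (- (l * m)), (1 - l * n); rewrite -rE.
    have lm0 : - (l * m) != 0.
      by rewrite oppr_eq0 mulf_neq0// gt_eqF// (lt_le_trans _ l1).
    split=> //; rewrite lt_neqAle eq_sym {1}rE nz//= subr_ge0 ll/=.
    by rewrite ek; lra.
  exists ((l + 1) * m), ((l + 1) * n - 1); rewrite -r'E; split.
    by rewrite mulf_neq0// gt_eqF// addr_gt0// (lt_le_trans _ l1).
  by rewrite ek; lra.
have [k ke] : exists k, 2 ^- k < e.
  exists (Num.bound e^-1); rewrite invf_plt ?posrE ?exprn_gt0//.
  exact: upper_nthrootP.
have [m [n [_ /andP[h0 h1]]]] := halving k.
by exists m, n; rewrite h0/= (le_lt_trans h1).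
Qed.

(** The multiples of a small positive element of the group form a fine grid. *)
Lemma irrational_combinations_dense (kappa a y : R) :
  ~ rational kappa -> 0 < a ->
  closure [set x | exists m n : int, x = a * (m%:~R * kappa + n%:~R)] y.
Proof.
move=> kirr a0 B /nbhs_ballP[e /= e0 eB].
have [m [n /andP[x0 xe]]] := irrational_combination_small kirr (divr_gt0 e0 a0).
set x := _ + _ in x0 xe.
have ax0 : 0 < a * x by rewrite mulr_gt0.
pose l := Num.floor (y / (a * x)).
exists (l%:~R * (a * x)); split.
  by exists (l * m), (l * n); rewrite !intrM /x; ring.
apply: eB; rewrite /ball/= ger0_norm.
  rewrite (@lt_trans _ _ (a * x))//; last by rewrite -ltr_pdivlMl// mulrC.
  have := floorD1_gt (y / (a * x)).
  by rewrite ltr_pdivrMr// intrD mulrDl mul1r addrC -ltrBlDr.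
by rewrite subr_ge0 -ler_pdivlMr// floor_le.
Qed.

(** * Linear algebra in the quaternions *)

Lemma quatE a b c d :
  ((quat a b c d) 0 0 = a) * ((quat a b c d) 0 1 = b) *
  ((quat a b c d) 0 2 = c) * ((quat a b c d) 0 3 = d).
Proof. by rewrite !mxE. Qed.

Lemma row4P u v : u 0 0 = v 0 0 -> u 0 1 = v 0 1 -> u 0 2 = v 0 2 ->
  u 0 3 = v 0 3 -> u = v.
Proof.
move=> h0 h1 h2 h3; apply/rowP => -[[|[|[|[|//]]]] Hi];
  [rewrite -[Ordinal _](_ : 0 = _)|rewrite -[Ordinal _](_ : 1 = _)
  |rewrite -[Ordinal _](_ : 2 = _)|rewrite -[Ordinal _](_ : 3 = _)] => //;
  exact/val_inj.
Qed.

Lemma dotE u v : dot u v =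
  u 0 0 * v 0 0 + u 0 1 * v 0 1 + u 0 2 * v 0 2 + u 0 3 * v 0 3.
Proof.
rewrite /dot !big_ord_recr big_ord0 /= add0r.
by congr (_ * _ + _ * _ + _ * _ + _ * _); congr (_ 0 _); exact/val_inj.
Qed.

Lemma fieldVE u : fieldV u = quat (- u 0 1) (u 0 0) (- u 0 3) (u 0 2).
Proof. by rewrite /fieldV /qmul/= !quatE; congr quat; ring. Qed.

Lemma fieldE1E u : fieldE1 u = quat (- u 0 2) (u 0 3) (u 0 0) (- u 0 1).
Proof. by rewrite /fieldE1 /qmul/= !quatE; congr quat; ring. Qed.

Lemma fieldE2E u : fieldE2 u = quat (- u 0 3) (- u 0 2) (u 0 1) (u 0 0).
Proof. by rewrite /fieldE2 /qmul/= !quatE; congr quat; ring. Qed.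

Lemma coordD u v i : (u + v) 0 i = u 0 i + v 0 i. Proof. by rewrite mxE. Qed.
Lemma coordN u i : (- u) 0 i = - u 0 i. Proof. by rewrite mxE. Qed.
Lemma coordZ a u i : (a *: u) 0 i = a * u 0 i. Proof. by rewrite mxE. Qed.

(** Rewriting with these equations turns an identity between vectors of R^4
    into polynomial identities between their coordinates. *)
Definition vecE :=
  (dotE, fieldVE, fieldE1E, fieldE2E, quatE, coordD, coordN, coordZ).

Lemma horizontal_ortho p v : horizontal_vector p v ->
  dot p v = 0 /\ dot (fieldV p) v = 0.
Proof. by move=> [a [b ->]]; rewrite !vecE; split; ring. Qed.

(** The difference quotients of a linear map are constant. *)
Lemma derive_linear (V W : normedModType R) (f : V -> W) (x v : V) :
  linear f -> 'D_v f x = f v.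
Proof.
move=> lf; apply: cvg_lim => //; apply: cvg_near_cst.
near=> h; have h0 : h != 0 by near: h; exact: nbhs_dnbhs_neq.
by rewrite /= lf addrK scalerA mulVf// scale1r.
Unshelve. all: by end_near. Qed.

(** For a horizontal v, the vector i v is horizontal too, hence already tangent
    to the sphere. *)
Lemma J_horizontal p v : horizontal_vector p v -> J p v = fieldV v.
Proof.
move=> hv; rewrite /J /cov_deriv derive_linear.
  rewrite /tangent_proj; case: hv => a [b ->].
  by apply: row4P; rewrite !vecE; ring.
by move=> c x y; apply: row4P; rewrite !vecE; ring.
Qed.

Lemma is_derive_coord n (f : R -> 'rV[R]_n) (df : 'rV[R]_n) (t : R) i :
  is_derive t 1 f df -> is_derive t 1 (fun t => f t 0 i) (df 0 i).
Proof.
move=> [fd <-]; apply: DeriveDef; first by have /derivable_mxP := fd.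
by rewrite derive_mx// mxE.
Qed.

(** * Solving the geodesic equation *)

(** This is z' = i mu z for z = x + i y: the components of exp(-i mu t) z have
    zero derivative. *)
Lemma rotation_ode (mu : R) (x y : R -> R) :
  (forall t : R, is_derive t 1 x (- mu * y t)) ->
  (forall t : R, is_derive t 1 y (mu * x t)) ->
  forall t, x t = cos (mu * t) * x 0 - sin (mu * t) * y 0 /\
            y t = cos (mu * t) * y 0 + sin (mu * t) * x 0.
Proof.
move=> dx dy t; have dc := is_derive_cosM mu; have ds := is_derive_sinM mu.
have c1 : x t * cos (mu * t) + y t * sin (mu * t) = x 0.
  pose c := fun t : R => x t * cos (mu * t) + y t * sin (mu * t).
  have c0 : c 0 = x 0 by rewrite /c mulr0 cos0 sin0; ring.
  rewrite -c0 -/(c t); apply: is_derive_0_is_cst => z.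
  have ? := dc z; have ? := ds z; have ? := dx z; have ? := dy z.
  by apply: is_derive_eq; rewrite /GRing.scale/=; ring.
have c2 : y t * cos (mu * t) - x t * sin (mu * t) = y 0.
  pose c := fun t : R => y t * cos (mu * t) - x t * sin (mu * t).
  have c0 : c 0 = y 0 by rewrite /c mulr0 cos0 sin0; ring.
  rewrite -c0 -/(c t); apply: is_derive_0_is_cst => z.
  have ? := dc z; have ? := ds z; have ? := dx z; have ? := dy z.
  by apply: is_derive_eq; rewrite /GRing.scale/=; ring.
have cs := cos2Dsin2 (mu * t); rewrite -c1 -c2.
split.
  by rewrite -[LHS]mulr1 -cs; ring.
by rewrite -[LHS]mulr1 -cs; ring.
Qed.

(** With z = x + i y the system is z'' = i (mu1 + mu2) z' - z.  Since
    mu1 mu2 = -1 it factors as (d/dt - i mu1) (d/dt - i mu2) z = 0, so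
    u = - i z' - mu2 z rotates with angular speed mu1 and w = i z' + mu1 z with
    angular speed mu2, while u + w = (mu1 - mu2) z.  The constants a1 + i b1 and
    a2 + i b2 are the values at 0 of u and w divided by mu1 - mu2. *)
Lemma magnetic_ode (mu1 mu2 : R) (x y x' y' : R -> R) :
  mu1 * mu2 = -1 -> mu1 != mu2 ->
  (forall t : R, is_derive t 1 x (x' t)) ->
  (forall t : R, is_derive t 1 y (y' t)) ->
  (forall t : R, is_derive t 1 x' (- x t - (mu1 + mu2) * y' t)) ->
  (forall t : R, is_derive t 1 y' (- y t + (mu1 + mu2) * x' t)) ->
  let a1 := (mu1 - mu2)^-1 * (y' 0 - mu2 * x 0) in
  let b1 := (mu1 - mu2)^-1 * (- x' 0 - mu2 * y 0) in
  let a2 := (mu1 - mu2)^-1 * (- y' 0 + mu1 * x 0) in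
  let b2 := (mu1 - mu2)^-1 * (x' 0 + mu1 * y 0) in
  forall t,
    x t = cos (mu1 * t) * a1 - sin (mu1 * t) * b1
        + (cos (mu2 * t) * a2 - sin (mu2 * t) * b2) /\
    y t = cos (mu1 * t) * b1 + sin (mu1 * t) * a1
        + (cos (mu2 * t) * b2 + sin (mu2 * t) * a2).
Proof.
move=> mu12 muN dx dy dx' dy' a1 b1 a2 b2 t.
have e r : mu1 * mu2 * r = - r by rewrite mu12 mulN1r.
have [|| u1 u2] := @rotation_ode mu1 (fun t => y' t - mu2 * x t)
    (fun t => - x' t - mu2 * y t) _ _ t.
- move=> z; have ? := dx z; have ? := dy z; have ? := dx' z; have ? := dy' z.
  apply: is_derive_eq; rewrite /GRing.scale/=.
  have := e (y z); lra.
- move=> z; have ? := dx z; have ? := dy z; have ? := dx' z; have ? := dy' z.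
  apply: is_derive_eq; rewrite /GRing.scale/=.
  have := e (x z); lra.
have [|| w1 w2] := @rotation_ode mu2 (fun t => - y' t + mu1 * x t)
    (fun t => x' t + mu1 * y t) _ _ t.
- move=> z; have ? := dx z; have ? := dy z; have ? := dx' z; have ? := dy' z.
  apply: is_derive_eq; rewrite /GRing.scale/=.
  have := e (y z); lra.
- move=> z; have ? := dx z; have ? := dy z; have ? := dx' z; have ? := dy' z.
  apply: is_derive_eq; rewrite /GRing.scale/=.
  have := e (x z); lra.
have m0 : mu1 - mu2 != 0 by rewrite subr_eq0.
split; apply: (mulfI m0).
  transitivity ((y' t - mu2 * x t) + (- y' t + mu1 * x t)); first by ring.
  by rewrite u1 w1 /a1 /b1 /a2 /b2; field.
transitivity ((- x' t - mu2 * y t) + (x' t + mu1 * y t)); first by ring.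
by rewrite u2 w2 /a1 /b1 /a2 /b2; field.
Qed.

(** Left multiplication by i identifies R^4 with C^2; this is the complex
    combination (a + i b) A + (c + i d) B. *)
Definition frame A B a b c d : 'rV[R]_4 :=
  a *: A + b *: fieldV A + (c *: B + d *: fieldV B).

Definition helix (mu1 mu2 : R) A B (t : R) :=
  frame A B (cos (mu1 * t)) (sin (mu1 * t)) (cos (mu2 * t)) (sin (mu2 * t)).

(** The last two conditions say that A and B are orthogonal for the Hermitian
    product of C^2. *)
Definition hermitian_splitting A B :=
  [/\ 0 < dot A A, 0 < dot B B, dot A A + dot B B = 1, dot A B = 0
    & dot (fieldV A) B = 0].

(** On a horizontal curve of unit speed, differentiating <gamma, gamma'> = 0
    gives <gamma'', gamma> = -1.  The covariant derivative is therefore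
    gamma'' + gamma, and the equation of geodesics becomes linear with constant
    coefficients in R^4. *)
Lemma geodesic_equation lambda (gamma : R -> 'rV[R]_4) :
  complete_geodesic lambda gamma ->
  [/\ forall t : R, is_derive t 1 gamma (derive1 gamma t),
      forall t : R, is_derive t 1 (derive1 gamma)
        (- gamma t - (2 * lambda) *: fieldV (derive1 gamma t)),
      forall t, dot (gamma t) (gamma t) = 1,
      forall t, dot (derive1 gamma t) (derive1 gamma t) = 1
    & forall t, dot (gamma t) (derive1 gamma t) = 0 /\
                dot (fieldV (gamma t)) (derive1 gamma t) = 0].
Proof.
move=> [S3g [dg Dg] hor unit eqn].
have der1 (t : R) : is_derive t 1 gamma (derive1 gamma t).
  apply: DeriveDef; first by apply/derivable1_diffP.
  by rewrite derive1E.
have der2 (t : R) : is_derive t 1 (derive1 gamma) (derive1 (derive1 gamma) t).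
  apply: DeriveDef; last by rewrite derive1E.
  apply/derivable1_diffP; have [+ _] := Dg 1.
  by rewrite (_ : (fun x => 'D_1 gamma x) = derive1 gamma)//;
     apply/funext => x; rewrite derive1E.
have ortho t := horizontal_ortho (hor t).
split=> // t; have := eqn t; rewrite /cov_deriv_along J_horizontal//.
have -> : tangent_proj (gamma t) (derive1 (derive1 gamma) t) =
          derive1 (derive1 gamma) t + gamma t.
  rewrite /tangent_proj.
  suff -> : dot (derive1 (derive1 gamma) t) (gamma t) = -1.
    by rewrite scaleN1r opprK.
  have d1 i := is_derive_coord i (der1 t).
  have d2 i := is_derive_coord i (der2 t).
  have h1 : is_derive t 1
      (fun t => gamma t 0 0 * (derive1 gamma t) 0 0
                + gamma t 0 1 * (derive1 gamma t) 0 1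
                + gamma t 0 2 * (derive1 gamma t) 0 2
                + gamma t 0 3 * (derive1 gamma t) 0 3)
      (dot (derive1 gamma t) (derive1 gamma t)
       + dot (derive1 (derive1 gamma) t) (gamma t)).
    have := d1 0; have := d1 1; have := d1 2; have := d1 3.
    have := d2 0; have := d2 1; have := d2 2; have := d2 3 => ? ? ? ? ? ? ? ?.
    apply: is_derive_eq; rewrite /GRing.scale/= !dotE; ring.
  have : is_derive t 1 (fun t => dot (gamma t) (derive1 gamma t)) 0.
    under eq_fun do rewrite (ortho _).1.
    exact: is_derive_cst.
  under eq_fun do rewrite dotE.
  move=> h0; have := @derive_val _ _ _ _ _ _ _ h1.
  rewrite (@derive_val _ _ _ _ _ _ _ h0) unit => ?; lra.
move=> e.
rewrite [X in is_derive _ _ _ X](_ : _ = derive1 (derive1 gamma) t)//.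
apply/eqP; rewrite -subr_eq0 -oppr_eq0; apply/eqP; rewrite -[RHS]e.
by rewrite !opprD !opprK addrC addrA.
Qed.

(** The frequencies are the roots of mu^2 + 2 lambda mu - 1, the characteristic
    equation of gamma'' + 2 lambda i gamma' + gamma = 0.  Their product is -1,
    and gamma, gamma' are orthonormal with gamma' orthogonal to i gamma; these
    facts make the two components Hermitian orthogonal. *)
Lemma geodesic_helix lambda (gamma : R -> 'rV[R]_4) :
  complete_geodesic lambda gamma ->
  let s := Num.sqrt (1 + lambda ^+ 2) in
  exists A B, hermitian_splitting A B /\
    gamma = helix (s - lambda) (- (s + lambda)) A B.
Proof.
move=> /geodesic_equation[der1 der2 S3g unit ortho] s.
have s0 : 0 < s by rewrite sqrtr_gt0 ltr_pwDl// sqr_ge0.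
have s2 : s ^+ 2 = 1 + lambda ^+ 2 by rewrite sqr_sqrtr// addr_ge0// sqr_ge0.
set mu1 := s - lambda; set mu2 := - (s + lambda).
have mu12 : mu1 * mu2 = -1 by rewrite /mu1 /mu2; lra.
have muN : mu1 != mu2 by rewrite /mu1 /mu2; apply/eqP; lra.
set k := (mu1 - mu2)^-1.
pose g0 := gamma 0; pose g1 := derive1 gamma 0.
(* The solution of A + B = g0 and i (mu1 A + mu2 B) = g1. *)
pose A := k *: (- fieldV g1 - mu2 *: g0).
pose B := k *: (fieldV g1 + mu1 *: g0).
exists A, B; split.
  have [og1 og2] := ortho 0; have n0 := S3g 0; have n1 := unit 0.
  have k0 : 0 < k by rewrite invr_gt0 /mu1 /mu2; lra.
  have kmu : k * (mu1 - mu2) = 1 by rewrite mulVf// subr_eq0.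
  have AA : dot A A = k ^+ 2 * (1 + mu2 ^+ 2).
    transitivity (k ^+ 2 * (dot g1 g1 + mu2 ^+ 2 * dot g0 g0
                            - 2 * mu2 * dot (fieldV g0) g1)).
      by rewrite /A !vecE; ring.
    by rewrite og2 n0 n1; ring.
  have BB : dot B B = k ^+ 2 * (1 + mu1 ^+ 2).
    transitivity (k ^+ 2 * (dot g1 g1 + mu1 ^+ 2 * dot g0 g0
                            - 2 * mu1 * dot (fieldV g0) g1)).
      by rewrite /B !vecE; ring.
    by rewrite og2 n0 n1; ring.
  split.
  - by rewrite AA mulr_gt0 ?exprn_gt0// ltr_pwDl// sqr_ge0.
  - by rewrite BB mulr_gt0 ?exprn_gt0// ltr_pwDl// sqr_ge0.
  - rewrite AA BB; transitivity ((k * (mu1 - mu2)) ^+ 2).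
      transitivity (k ^+ 2 * (mu1 ^+ 2 + mu2 ^+ 2 - 2 * -1)); first by ring.
      by rewrite -mu12; ring.
    by rewrite kmu expr1n.
  - transitivity (k ^+ 2 * (- dot g1 g1 - mu1 * mu2 * dot g0 g0
                            + (mu1 + mu2) * dot (fieldV g0) g1)).
      by rewrite /A /B !vecE; ring.
    by rewrite og2 n0 n1 mu12; ring.
  - transitivity (k ^+ 2 * (mu1 - mu2) * dot g0 g1).
      by rewrite /A /B !vecE; ring.
    by rewrite og1 mulr0.
apply/funext => t.
have d1 i t' := is_derive_coord i (der1 t').
have d2 i t' := is_derive_coord i (der2 t').
have mu2l : mu1 + mu2 = - (2 * lambda) by rewrite /mu1 /mu2; ring.
have [| |h0 h1] := magnetic_ode mu12 muN (d1 0) (d1 1) _ _ t.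
- by move=> z; have := d2 0 z; rewrite !vecE mu2l; congr is_derive; ring.
- by move=> z; have := d2 1 z; rewrite !vecE mu2l; congr is_derive; ring.
have [| |h2 h3] := magnetic_ode mu12 muN (d1 2) (d1 3) _ _ t.
- by move=> z; have := d2 2 z; rewrite !vecE mu2l; congr is_derive; ring.
- by move=> z; have := d2 3 z; rewrite !vecE mu2l; congr is_derive; ring.
apply: row4P; rewrite /helix /frame /A /B !vecE -/g0 -/g1.
- by rewrite h0 -/k -/g0 -/g1; ring.
- by rewrite h1 -/k -/g0 -/g1; ring.
- by rewrite h2 -/k -/g0 -/g1; ring.
- by rewrite h3 -/k -/g0 -/g1; ring.
Qed.

(** The vectors A, iA, B, iB are orthogonal and nonzero, so the inner products
    with them recover the coefficients. *)
Lemma frame_inj A B a b c d a' b' c' d' : hermitian_splitting A B ->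
  frame A B a b c d = frame A B a' b' c' d' ->
  [/\ a = a', b = b', c = c' & d = d'].
Proof.
move=> [A0 B0 _ AB iAB] eq.
have h w : dot w (frame A B a b c d) = dot w (frame A B a' b' c' d').
  by rewrite eq.
have dotf w e f g k : dot w (frame A B e f g k) =
    e * dot w A + f * dot w (fieldV A) + (g * dot w B + k * dot w (fieldV B)).
  by rewrite /frame !vecE; ring.
have uAA : dot A (fieldV A) = 0 by rewrite !vecE; ring.
have uBB : dot B (fieldV B) = 0 by rewrite !vecE; ring.
have AiB : dot A (fieldV B) = 0 by rewrite -oppr0 -iAB !vecE; ring.
have BiA : dot B (fieldV A) = 0 by rewrite -iAB !vecE; ring.
have BA : dot B A = 0 by rewrite -AB !vecE; ring.
have iAA : dot (fieldV A) A = 0 by rewrite -uAA !vecE; ring.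
have iBB : dot (fieldV B) B = 0 by rewrite -uBB !vecE; ring.
have iBA : dot (fieldV B) A = 0 by rewrite -AiB !vecE; ring.
have iAiA : dot (fieldV A) (fieldV A) = dot A A by rewrite !vecE; ring.
have iBiB : dot (fieldV B) (fieldV B) = dot B B by rewrite !vecE; ring.
have iAiB : dot (fieldV A) (fieldV B) = 0 by rewrite -AB !vecE; ring.
have iBiA : dot (fieldV B) (fieldV A) = 0 by rewrite -AB !vecE; ring.
have nA := lt0r_neq0 A0; have nB := lt0r_neq0 B0.
split.
- by have := h A; rewrite !dotf uAA AB AiB !mulr0 !addr0 => /(mulIf nA).
- have := h (fieldV A); rewrite !dotf iAA iAiA iAB iAiB.
  by rewrite !mulr0 !addr0 !add0r => /(mulIf nA).
- have := h B; rewrite !dotf BA BiA uBB.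
  by rewrite !mulr0 !addr0 !add0r => /(mulIf nB).
- have := h (fieldV B); rewrite !dotf iBA iBiA iBB iBiB.
  by rewrite !mulr0 !add0r => /(mulIf nB).
Qed.

Lemma smooth_frame (V : normedModType R) A B (a b c d : V -> R) :
  smooth a -> smooth b -> smooth c -> smooth d ->
  smooth (fun x => frame A B (a x) (b x) (c x) (d x)).
Proof.
by move=> sa sb sc sd k; rewrite /frame; repeat apply: CkD; apply: CkZl.
Qed.

(** * Density in a Clifford torus *)

(** Orthogonality of A and iA to B makes the first two coordinates of
    B * conj(A) vanish.  Hence right multiplication by q = conj(A) / |A| puts A
    on the real axis and B in the plane spanned by j and k.  It commutes with left
    multiplication by i, which determines the images of all combinations. *)
Lemma right_translation_frame A B : hermitian_splitting A B ->
  exists2 q, S3 q & exists x y, x ^+ 2 + y ^+ 2 = dot B B /\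
    forall a b c d, right_translation q (frame A B a b c d) =
      quat (Num.sqrt (dot A A) * a) (Num.sqrt (dot A A) * b)
           (c * x - d * y) (c * y + d * x).
Proof.
move=> [A0 B0 _ AB iAB].
set rho := Num.sqrt (dot A A).
have r0 : 0 < rho by rewrite sqrtr_gt0.
have rr : rho ^+ 2 = dot A A by rewrite sqr_sqrtr// ltW.
have rV : rho^-1 * dot A A = rho by rewrite -rr expr2 mulKf// gt_eqF.
pose q := rho^-1 *: quat (A 0 0) (- A 0 1) (- A 0 2) (- A 0 3).
have Aq : qmul A q = quat rho 0 0 0.
  apply: row4P; rewrite /qmul/= /q !quatE !coordZ !quatE.
  - by rewrite -[RHS]rV dotE; ring.
  - by ring.
  - by ring.
  - by ring.
have qq : dot q q = 1.
  rewrite -[RHS](expr1n _ 2) -(mulVf (lt0r_neq0 r0)) exprMn rr /q !vecE; ring.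
exists q => //.
exists ((qmul B q) 0 2), ((qmul B q) 0 3).
have Bq0 : (qmul B q) 0 0 = 0.
  rewrite /qmul/= /q !quatE !coordZ !quatE.
  by rewrite -(mulr0 rho^-1) -AB dotE; ring.
have Bq1 : (qmul B q) 0 1 = 0.
  rewrite /qmul/= /q !quatE !coordZ !quatE.
  by rewrite -(mulr0 rho^-1) -iAB !vecE; ring.
split.
  transitivity (dot (qmul B q) (qmul B q)).
    by rewrite dotE Bq0 Bq1; ring.
  by rewrite -[RHS]mulr1 -qq /qmul/= !vecE; ring.
move=> a b c d.
have -> : right_translation q (frame A B a b c d) =
    frame (qmul A q) (qmul B q) a b c d.
  by apply: row4P; rewrite /right_translation /frame /qmul/= !vecE; ring.
rewrite Aq; move: (qmul B q) Bq0 Bq1 => C C0 C1.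
apply: row4P; rewrite /frame !vecE ?C0 ?C1; ring.
Qed.

(** After the right translation the curve is
    (rho exp(i mu1 t), exp(i mu2 t) (x + i y)).  The times
    t = (th1 + 2 pi m) / mu1, for integers m, give the first coordinate the
    prescribed argument th1 exactly, and along them the second coordinate has
    argument (mu2 / mu1) (th1 + 2 pi m) modulo 2 pi, which is dense because
    mu2 / mu1 is irrational. *)
Lemma helix_dense mu1 mu2 A B : hermitian_splitting A B ->
  mu1 != 0 -> ~ rational (mu2 / mu1) ->
  exists2 q, S3 q & exists2 rho : R, 0 < rho < 1 &
    dense_in (right_translation q @` range (helix mu1 mu2 A B))
             (clifford_torus rho).
Proof.
move=> hAB m0 kirr; have [A0 B0 AB1 _ _] := hAB.
have [q Sq [x [y [xyB tr]]]] := right_translation_frame hAB.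
set rho := Num.sqrt (dot A A) in tr.
have r0 : 0 < rho by rewrite sqrtr_gt0.
have rr : rho ^+ 2 = dot A A by rewrite sqr_sqrtr// ltW.
exists q => //; exists rho; first by rewrite r0/=; nra.
split.
  move=> _ [_ [t _ <-] <-]; rewrite /clifford_torus/= /S3/= /helix tr !vecE.
  have c1 := cos2Dsin2 (mu1 * t); have c2 := cos2Dsin2 (mu2 * t).
  split; last by rewrite -[RHS]mulr1 -c1; ring.
  rewrite -[RHS]AB1 -rr -xyB.
  rewrite -[in RHS](mulr1 (rho ^+ 2)) -[in RHS](mulr1 (_ + y ^+ 2)).
  by rewrite -{1}c1 -c2; ring.
move=> p [pS pr]; rewrite /S3/= dotE in pS.
have [th1 [p0 p1]] : exists th, p 0 0 / rho = cos th /\ p 0 1 / rho = sin th.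
  apply: polar_coordinates; rewrite !expr_div_n -mulrDl pr divff//.
  by rewrite expf_neq0// gt_eqF.
have n2 : p 0 2 ^+ 2 + p 0 3 ^+ 2 = dot B B by lra.
(* th2 is the angle from x + i y to the second complex coordinate of p. *)
have [th2 [p2 p3]] : exists th, (p 0 2 * x + p 0 3 * y) / dot B B = cos th /\
      (p 0 3 * x - p 0 2 * y) / dot B B = sin th.
  apply: polar_coordinates; rewrite !expr_div_n -mulrDl.
  transitivity ((p 0 2 ^+ 2 + p 0 3 ^+ 2) * (x ^+ 2 + y ^+ 2) / dot B B ^+ 2).
    by congr (_ / _); ring.
  by rewrite n2 xyB -expr2 divff// expf_neq0// gt_eqF.
(* The circle of the torus through p on which the first coordinate is fixed. *)
pose F (th : R) := quat (rho * cos th1) (rho * sin th1)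
   (cos th * x - sin th * y) (cos th * y + sin th * x).
have -> : p = F th2.
  apply: row4P; rewrite /F !quatE.
  - by rewrite -p0 mulrC divfK// gt_eqF.
  - by rewrite -p1 mulrC divfK// gt_eqF.
  - rewrite -p2 -p3; apply: (mulIf (lt0r_neq0 B0)).
    rewrite mulrBl mulrAC divfK ?gt_eqF// [X in _ - X]mulrAC divfK ?gt_eqF//.
    by rewrite -xyB; ring.
  - rewrite -p2 -p3; apply: (mulIf (lt0r_neq0 B0)).
    rewrite mulrDl mulrAC divfK ?gt_eqF// [X in _ + X]mulrAC divfK ?gt_eqF//.
    by rewrite -xyB; ring.
have p2pos : 0 < (pi : R) *+ 2 by rewrite pmulrn_lgt0 ?pi_gt0.
have cD := irrational_combinations_dense (y := th2 - mu2 / mu1 * th1)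
  kirr p2pos.
have cF : continuous F.
  rewrite (_ : F = fun th => quat (rho * cos th1) (rho * sin th1) 0 0 +
    (cos (1 * th) *: quat 0 0 x y + sin (1 * th) *: quat 0 0 (- y) x)).
    apply: (CkD (k := 0)); first exact: smooth_cst.
    by apply: (CkD (k := 0)); apply: (CkZl (k := 0));
      [exact: smooth_cosM|exact: smooth_sinM].
  by apply/funext => th; apply: row4P; rewrite /F mul1r !vecE; ring.
move=> N /cF FN.
pose sh (z : R) := z + mu2 / mu1 * th1.
have shN : nbhs (th2 - mu2 / mu1 * th1) ((F \o sh) @^-1` N).
  have shc : sh z @[z --> th2 - mu2 / mu1 * th1] --> th2.
    rewrite -[X in _ --> X](subrK (mu2 / mu1 * th1)).
    by apply: cvgD; [exact: cvg_id|exact: cvg_cst].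
  exact: shc _ FN.
have [z [[m [n zE]] Nz]] := cD _ shN.
exists (F (sh z)); split=> //.
exists (helix mu1 mu2 A B ((th1 + m%:~R * (pi *+ 2)) / mu1)).
  by exists ((th1 + m%:~R * (pi *+ 2)) / mu1).
rewrite /helix tr mulrCA divff// mulr1 !trigD2pi_int /F.
have -> : mu2 * ((th1 + m%:~R * (pi *+ 2)) / mu1) =
          sh z + (- n)%:~R * (pi *+ 2).
  by rewrite /sh zE mulrNz; ring.
by rewrite !trigD2pi_int.
Qed.

(** * Closed and injective helices *)

(** If kappa is the quotient of the two frequencies, then
    lambda / s = (kappa + 1) / (kappa - 1). *)
Lemma rational_of_frequency_ratio (lambda s : R) : s - lambda != 0 -> s != 0 ->
  rational (- (s + lambda) / (s - lambda)) -> rational (lambda / s).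
Proof.
move=> sl s0 [r rE]; exists ((r + 1) / (r - 1)).
rewrite fmorph_div rmorphD rmorphB !rmorph1/= -rE.
field; rewrite sl s0 /= andbT (_ : _ + _ = - (2 * s)); last by ring.
by rewrite oppr_eq0 mulf_neq0.
Qed.

(** The numerator and denominator of (1 - r) / (1 + r), where r = lambda / s,
    are the windings m and n; being coprime, they give tau, and not a proper
    multiple of it, as basic frequency of the curve. *)
Lemma coprime_frequencies (lambda s : R) : 0 < s -> `|lambda| < s ->
  rational (lambda / s) -> exists m n : nat, exists2 tau : R, 0 < tau &
    [/\ coprime m n, s - lambda = m%:R * tau & s + lambda = n%:R * tau].
Proof.
move=> s0; rewrite ltr_norml => /andP[l1 l2] [r rE].
have sp : 0 < s + lambda by lra.
have sm : 0 < s - lambda by lra.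
pose x := (1 - r) / (1 + r).
have xE : ratr x = (s - lambda) / (s + lambda) :> R.
  rewrite fmorph_div rmorphB rmorphD !rmorph1/= -rE.
  by field; rewrite !gt_eqF.
have x0 : 0 < x by rewrite -(ltr0q R) xE divr_gt0.
exists `|numq x|%N, `|denq x|%N, ((s + lambda) / (denq x)%:~R).
  by rewrite divr_gt0// ltr0z denq_gt0.
have d0 : (denq x)%:~R != 0 :> R by rewrite intr_eq0 denq_neq0.
have nE : `|numq x|%N%:R = (numq x)%:~R :> R.
  by rewrite natr_absz gtr0_norm// numq_gt0.
have dE : `|denq x|%N%:R = (denq x)%:~R :> R.
  by rewrite natr_absz gtr0_norm// denq_gt0.
split; first exact: coprime_num_den.
- rewrite nE mulrCA -[_ / _]/(ratr x) xE mulrC divfK// gt_eqF//.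
- by rewrite dE mulrC divfK.
Qed.

(** The real and imaginary parts of (x + i y)^n, as polynomials in x and y. *)
Fixpoint zpow (n : nat) (x y : R) : R * R :=
  if n is n'.+1 then
    let z := zpow n' x y in (x * z.1 - y * z.2, x * z.2 + y * z.1)
  else (1, 0).

Lemma zpow_polar n (th : R) :
  zpow n (cos th) (sin th) = (cos (n%:R * th), sin (n%:R * th)).
Proof.
elim: n => [|n IH]/=; first by rewrite mul0r cos0 sin0.
by rewrite IH -natr1 mulrDl mul1r addrC cosD sinD/=; congr pair; ring.
Qed.

Lemma smooth_zpow n :
  smooth (fun v : 'rV[R]_2 => (zpow n (v 0 0) (v 0 1)).1) /\
  smooth (fun v : 'rV[R]_2 => (zpow n (v 0 0) (v 0 1)).2).
Proof.
have cx := @smooth_coord 2 0; have cy := @smooth_coord 2 1.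
elim: n => [|n [IH1 IH2]]/=; first by split; exact: smooth_cst.
split=> k.
  rewrite (_ : (fun _ => _) = fun v : 'rV[R]_2 =>
    v 0 0 * (zpow n (v 0 0) (v 0 1)).1 +
    (-1) * (v 0 1 * (zpow n (v 0 0) (v 0 1)).2)).
    apply: CkD; first by apply: CkM; [exact: cx|exact: IH1].
    apply: CkM; first exact: smooth_cst.
    by apply: CkM; [exact: cy|exact: IH2].
  by apply/funext => v; ring.
apply: CkD; first by apply: CkM; [exact: cx|exact: IH2].
by apply: CkM; [exact: cy|exact: IH1].
Qed.

Lemma unit_circleP (v : 'rV[R]_2) : unit_circle v <->
  exists th, v = \row_(i < 2) [:: cos th; sin th]`_i.
Proof.
split=> [/polar_coordinates[th [v0 v1]]|[th ->]].
  exists th; apply/rowP => -[[|[|//]]] Hi; rewrite mxE/= -?v0 -?v1;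
    congr (v 0 _); exact/val_inj.
by rewrite /unit_circle/= !mxE/= cos2Dsin2.
Qed.

(** A Bezout relation between m and n. *)
Lemma coprime_multiples_full_turn (m n : nat) (x : R) (k l : int) :
  coprime m n ->
  m%:R * x = k%:~R * (pi *+ 2) -> n%:R * x = l%:~R * (pi *+ 2) ->
  exists j : int, x = j%:~R * (pi *+ 2).
Proof.
move=> cmn mk nl.
have [[u v] /= uv] := coprimezP m n cmn.
exists (u * k + v * l).
rewrite intrD !intrM mulrDl -!mulrA -mk -nl !mulrA -mulrDl.
have := congr1 (fun z : int => z%:~R : R) uv.
by rewrite intrD !intrM => ->; rewrite mul1r.
Qed.

(** When the frequencies are m tau and - n tau, the curve is the image of the
    unit circle, run through at speed tau, under z |-> z^m A + conj(z)^n B.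
    This map is polynomial, hence smooth on the whole plane, and it is injective
    on the circle because m and n are coprime. *)
Lemma helix_circle_param (tau : R) (m n : nat) A B : tau != 0 -> coprime m n ->
  hermitian_splitting A B ->
  exists (h : R -> 'rV[R]_2) (phi : 'rV[R]_2 -> 'rV[R]_4),
    [/\ smooth h, range h = unit_circle, smooth phi, set_inj unit_circle phi
    & forall t, helix (m%:R * tau) (- (n%:R * tau)) A B t = phi (h t)].
Proof.
move=> t0 cmn hAB.
pose h (t : R) : 'rV[R]_2 := \row_(i < 2) [:: cos (tau * t); sin (tau * t)]`_i.
pose phi (v : 'rV[R]_2) : 'rV[R]_4 :=
  let z := zpow m (v 0 0) (v 0 1) in let w := zpow n (v 0 0) (v 0 1) in
  frame A B z.1 z.2 w.1 (-1 * w.2).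
have phiE th : phi (\row_(i < 2) [:: cos th; sin th]`_i) =
    frame A B (cos (m%:R * th)) (sin (m%:R * th))
              (cos (n%:R * th)) (- sin (n%:R * th)).
  by rewrite /phi !mxE/= !zpow_polar/= mulN1r.
exists h, phi; split.
- move=> k; rewrite (_ : h = fun t => cos (tau * t) *: delta_mx 0 0 +
                                      sin (tau * t) *: delta_mx 0 1).
    by apply: CkD; apply: CkZl; [exact: smooth_cosM|exact: smooth_sinM].
  apply/funext => t; apply/rowP => -[[|[|//]]] Hi; rewrite !mxE/=;
    by rewrite ?(mulr1, mulr0, addr0, add0r).
- apply/seteqP; split=> [_ [t _ <-]|v /unit_circleP[th ->]].
    by apply/unit_circleP; exists (tau * t).
  by exists (th / tau) => //; rewrite /h mulrCA divff// mulr1.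
- have [m1 m2] := smooth_zpow m; have [n1 n2] := smooth_zpow n.
  apply: smooth_frame => // k.
  by apply: CkM; [exact: smooth_cst|exact: n2].
- move=> _ _ /set_mem/unit_circleP[a ->] /set_mem/unit_circleP[b ->].
  rewrite !phiE => /(frame_inj hAB)[e1 e2 e3 /oppr_inj e4].
  have [k] := equal_angles e1 e2; rewrite -mulrBr => ek.
  have [l] := equal_angles e3 e4; rewrite -mulrBr => el.
  have [j ej] := coprime_multiples_full_turn cmn ek el.
  by rewrite -(subrK b a) ej addrC !trigD2pi_int.
- move=> t; rewrite /helix phiE.
  by congr frame; rewrite ?mulNr ?cosN ?sinN -?mulrA.
Qed.

Lemma helix_line_param mu1 mu2 A B :
  injective (helix mu1 mu2 A B) ->
  exists (h : R -> R) (phi : R -> 'rV[R]_4),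
    [/\ smooth h, range h = straight_line, smooth phi, set_inj straight_line phi
    & forall t, helix mu1 mu2 A B t = phi (h t)].
Proof.
move=> inj; exists id, (helix mu1 mu2 A B); split=> //.
- case=> [|k]; first by move=> x; exact: cvg_id.
  split=> [x|v]; first by exact: ex_diff.
  by under eq_fun do rewrite derive_id; exact: smooth_cst.
- by apply/seteqP; split=> // x _; exists x.
- by apply: smooth_frame; (exact: smooth_cosM || exact: smooth_sinM).
- by move=> x y _ _; exact: inj.
Qed.

(** If two times give the same point, both angles have changed by whole numbers
    of turns, and the quotient of these numbers is the ratio of the frequencies.
    This covers both periodicity and failure of injectivity. *)
Lemma helix_collision_rational mu1 mu2 A B (x y : R) :
  hermitian_splitting A B -> mu1 != 0 ->
  helix mu1 mu2 A B x = helix mu1 mu2 A B y -> x != y ->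
  rational (mu2 / mu1).
Proof.
move=> hAB m0; rewrite !/helix => /(frame_inj hAB)[e1 e2 e3 e4] xy.
have [k] := equal_angles e1 e2; rewrite -mulrBr => ek.
have [l] := equal_angles e3 e4; rewrite -mulrBr => el.
have xy0 : x - y != 0 by rewrite subr_eq0.
exists (l%:~R / k%:~R); rewrite fmorph_div/= !rmorph_int.
have p0 : (pi : R) *+ 2 != 0 by rewrite gt_eqF// pmulrn_lgt0 ?pi_gt0.
have k0 : k%:~R != 0 :> R.
  apply/eqP => k0; move: ek; rewrite k0 mul0r => /eqP.
  by rewrite mulf_eq0 (negbTE m0) (negbTE xy0).
apply/eqP; rewrite eqr_div//; apply/eqP; apply: (mulIf (mulf_neq0 xy0 p0)).
transitivity ((mu2 * (x - y)) * (k%:~R * (pi *+ 2))); first by ring.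
by rewrite -ek el; ring.
Qed.

End Geodesics.

Theorem proposition3p3 (R : realType) (lambda : R) (gamma : R -> 'rV[R]_4)
    (hgamma : complete_geodesic lambda gamma) :
  ((closed_curve gamma /\ curve_diffeomorphic_to gamma unit_circle) <->
   rational (lambda / Num.sqrt (1 + lambda ^+ 2))) /\
  (~ rational (lambda / Num.sqrt (1 + lambda ^+ 2)) ->
   curve_diffeomorphic_to gamma straight_line /\
   exists2 q : 'rV[R]_4, S3 q &
     exists2 rho : R, 0 < rho < 1 &
       dense_in (right_translation q @` range gamma) (clifford_torus rho)).
Proof.
have regular t : derive1 gamma t != 0.
  have [_ _ _ unit _] := geodesic_equation hgamma.
  apply/eqP => g0; have := unit t; rewrite g0 !vecE !mxE => /esym/eqP.
  by rewrite !mulr0 !addr0 oner_eq0.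
have [A [B [hAB gE]]] := geodesic_helix hgamma.
set s := Num.sqrt _ in gE *.
have s0 : 0 < s by rewrite sqrtr_gt0 ltr_pwDl// sqr_ge0.
have sl : `|lambda| < s by rewrite -sqrtr_sqr ltr_sqrt; nra.
have mu1 : s - lambda != 0.
  by have := sl; rewrite ltr_norml => /andP[_ ?]; apply/eqP; lra.
have irr : ~ rational (lambda / s) ->
           ~ rational (- (s + lambda) / (s - lambda)).
  apply: contra_not; apply: rational_of_frequency_ratio => //.
  by rewrite gt_eqF.
split; first split.
- move=> [[T T0 per] _].
  apply: rational_of_frequency_ratio => //; first by rewrite gt_eqF.
  apply: (helix_collision_rational (x := T) (y := 0) hAB mu1).
    by rewrite -gE -[in LHS](add0r T) per.
  by rewrite gt_eqF.
- move=> rat.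
  have [m [n [tau tau0 [cmn m1 n1]]]] := coprime_frequencies s0 sl rat.
  have [h [phi]] := helix_circle_param (lt0r_neq0 tau0) cmn hAB.
  rewrite -m1 -n1 -gE => hphi; split; last by split=> //; exists h, phi.
  exists (tau^-1 * (pi *+ 2)).
    by rewrite mulr_gt0 ?invr_gt0// pmulrn_lgt0 ?pi_gt0.
  have tK (k : nat) t : k%:R * tau * (t + tau^-1 * (pi *+ 2)) =
                        k%:R * tau * t + k%:~R * (pi *+ 2).
    by rewrite mulrDr -!mulrA mulVKf ?gt_eqF// -pmulrn.
  by move=> t; rewrite gE !/helix m1 n1 !mulNr !cosN !sinN !tK !trigD2pi_int.
move=> /irr kirr; split.
  split=> //; rewrite gE; apply: helix_line_param => // x y exy.
  apply: contra_notP kirr => /eqP; exact: helix_collision_rational exy.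
rewrite gE; exact: helix_dense.
Qed.
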